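(* Let $n\ge 2$ and $c\ge 2$. Let $f:\mathbb{B}^n\to\mathbb{H}^n=f(\mathbb{B}^n)$ be a Möbius transformation. Then, for all $x,y\in\mathbb{B}^n$, $$h_{\mathbb{B}^n,c}(x,y)\le h_{\mathbb{H}^n,c}(f(x),f(y))\le 2\,h_{\mathbb{B}^n,c}(x,y),$$ and the constants $1$ and $2$ are the best possible; that is, if $C>0$ satisfies $C\,h_{\mathbb{B}^n,c}(x,y)\le h_{\mathbb{H}^n,c}(f(x),f(y))$ for all $x,y\in\mathbb{B}^n$, then $C\le 1$, and if $C>0$ satisfies $h_{\mathbb{H}^n,c}(f(x),f(y))\le C\,h_{\mathbb{B}^n,c}(x,y)$ for all $x,y\in\mathbb{B}^n$, then $C\ge 2$.
   Context: $\mathbb{R}^n$ carries the Euclidean norm $|\cdot|$; $\mathbb{B}^n=\{x\in\mathbb{R}^n:|x|<1\}$ is the open unit ball and $\mathbb{H}^n=\{x=(x_1,\dots,x_n)\in\mathbb{R}^n:x_n>0\}$ is the upper half space. For a nonempty open set $D\subset\mathbb{R}^n$ with nonempty boundary $\partial D$ (taken in $\mathbb{R}^n$), let $d_D(x)=\inf_{z\in\partial D}|x-z|$ and, for $x,y\in D$, $$h_{D,c}(x,y)=\log\left(1+c\,\frac{|x-y|}{\sqrt{d_D(x)\,d_D(y)}}\right).$$ In particular $d_{\mathbb{B}^n}(x)=1-|x|$ for $x\in\mathbb{B}^n$ and $d_{\mathbb{H}^n}(x)=x_n$ for $x\in\mathbb{H}^n$. For $c\ge 2$, $h_{D,c}$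 is a metric on $D$. A Möbius transformation of a domain onto another is the restriction to the domain of a Möbius transformation of $\overline{\mathbb{R}^n}=\mathbb{R}^n\cup\{\infty\}$ (a finite composition of reflections in hyperplanes and inversions in spheres; orientation-reversing maps are allowed). *)

(* Defs.v *)
From HB Require Import structures.
From mathcomp Require Import all_boot all_order all_algebra.
From mathcomp Require Import all_classical all_reals all_analysis.
Import Order.TTheory GRing.Theory Num.Theory.
Import numFieldNormedType.Exports.

Set Implicit Arguments.
Unset Strict Implicit.
Unset Printing Implicit Defensive.

Local Open Scope classical_set_scope.
Local Open Scope ring_scope.

Section Defs.
Variables (R : realType) (n : nat).
Implicit Types (x y a : 'rV[R]_n) (D E : set 'rV[R]_n).

(* The library norm on 'rV[R]_n is the sup norm, so the Euclidean norm is
   defined here; both induce the topology used in [boundary]. *)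
Definition dot x y : R := \sum_(i < n) x ord0 i * y ord0 i.

Definition enorm x : R := Num.sqrt (dot x x).

Definition unit_ball : set 'rV[R]_n := [set x | enorm x < 1].

(* The index i with i + 1 = n is that of the last coordinate. *)
Definition half_space : set 'rV[R]_n :=
  [set x | exists2 i : 'I_n, i.+1 = n & 0 < x ord0 i].

Definition boundary D : set 'rV[R]_n := closure D `\` interior D.

Definition bdist D x : R := inf [set enorm (x - z) | z in boundary D].

Definition hmetric D (c : R) x y : R :=
  ln (1 + c * (enorm (x - y) / Num.sqrt (bdist D x * bdist D y))).

(* [None] is the point at infinity of R^n U {oo}. *)
Definition reflection a (t : R) (p : option 'rV[R]_n) : option 'rV[R]_n :=
  if p is Some x then Some (x - (2 * (dot x a - t) / dot a a) *: a) else None.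

Definition inversion a (r : R) (p : option 'rV[R]_n) : option 'rV[R]_n :=
  if p is Some x then
    if x == a then None
    else Some (a + (r ^+ 2 / enorm (x - a) ^+ 2) *: (x - a))
  else Some a.

Inductive moebius : (option 'rV[R]_n -> option 'rV[R]_n) -> Prop :=
| moebius_id : moebius id
| moebius_reflection a t g :
    a != 0 -> moebius g -> moebius (reflection a t \o g)
| moebius_inversion a r g :
    0 < r -> moebius g -> moebius (inversion a r \o g).

(* Only the values of f on D are constrained. *)
Definition moebius_onto D E (f : 'rV[R]_n -> 'rV[R]_n) : Prop :=
  f @` D = E /\
  exists2 g, moebius g & forall x, D x -> g (Some x) = Some (f x).

End Defs.

Arguments unit_ball {R n}.
Arguments half_space {R n}.

(* Main.v *)
(* Lift the one-point compactification of R^n to the light cone of R^(n+1,1).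
   A Moebius map g then satisfies |g x - g y|^2 = w(x) w(y) |x - y|^2 for a
   positive w, and it pulls every sphere function al |x|^2 + <b, x> + ga back
   to w times another one with the same discriminant |b|^2 - 4 al ga.  Applied
   to the last coordinate, which is positive exactly on the half space, this
   gives f(x)_n = w(x) (1 - |x|^2) / 2 on the ball.  Hence the ratios s and t
   inside the two logarithms satisfy
     t = s * 2 / sqrt ((1 + |x|) (1 + |y|)),   so   s <= t <= 2 s,
   and 1 + c t <= (1 + c s)^2.  Antipodal points tending to the sphere show
   that 1 is optimal; pairs (0, y) with y tending to 0 show that 2 is. *)
Require Import Defs.
From mathcomp Require Import all_boot all_order all_algebra.
From mathcomp Require Import all_classical all_reals all_analysis.
From mathcomp Require Import ring lra.
Import Order.TTheory GRing.Theory Num.Theory.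
Import numFieldNormedType.Exports.
Set Implicit Arguments.
Unset Strict Implicit.
Unset Printing Implicit Defensive.
Local Open Scope classical_set_scope.
Local Open Scope ring_scope.

(** * Euclidean inner product and norm *)

Section Dot.
Variables (R : realType) (n : nat).
Implicit Types (x y z a b : 'rV[R]_n) (k : R).

Lemma dotC x y : dot x y = dot y x.
Proof. by apply: eq_bigr => i _; rewrite mulrC. Qed.

Lemma dotDl x y z : dot (x + y) z = dot x z + dot y z.
Proof. by rewrite -big_split; apply: eq_bigr => i _; rewrite !mxE mulrDl. Qed.

Lemma dotZl k x y : dot (k *: x) y = k * dot x y.
Proof. by rewrite mulr_sumr; apply: eq_bigr => i _; rewrite !mxE mulrA. Qed.

Lemma dot0l x : dot 0 x = 0.
Proof. by rewrite -(scale0r 0) dotZl mul0r. Qed.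

Lemma dotNl x y : dot (- x) y = - dot x y.
Proof. by rewrite -scaleN1r dotZl mulN1r. Qed.

Lemma dotDr x y z : dot x (y + z) = dot x y + dot x z.
Proof. by rewrite !(dotC x) dotDl. Qed.

Lemma dotZr k x y : dot x (k *: y) = k * dot x y.
Proof. by rewrite !(dotC x) dotZl. Qed.

Lemma dotNr x y : dot x (- y) = - dot x y.
Proof. by rewrite !(dotC x) dotNl. Qed.

Definition dotE := (dotDl, dotDr, dotNl, dotNr, dotZl, dotZr).

Lemma dot_delta i x : dot (delta_mx ord0 i) x = x ord0 i.
Proof.
rewrite /dot (bigD1 i) //= !mxE !eqxx mul1r big1 ?addr0 // => j ji.
by rewrite !mxE (negbTE ji) andbF mul0r.
Qed.

Lemma dot_ge0 x : 0 <= dot x x.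
Proof. by apply: sumr_ge0 => i _; rewrite -expr2 sqr_ge0. Qed.

Lemma dot_eq0 x : (dot x x == 0) = (x == 0).
Proof.
apply/idP/eqP => [|->]; last by rewrite dot0l.
rewrite psumr_eq0 => [/allP h|i _]; last by rewrite -expr2 sqr_ge0.
apply/rowP => i; rewrite mxE; apply/eqP.
by have := h i (mem_index_enum i); rewrite -expr2 sqrf_eq0.
Qed.

Lemma dot_gt0 x : x != 0 -> 0 < dot x x.
Proof. by move=> x0; rewrite lt_def dot_eq0 x0 dot_ge0. Qed.

Lemma CauchySchwarz_dot x y : dot x y ^+ 2 <= dot x x * dot y y.
Proof.
have [->|y0] := eqVneq y 0; first by rewrite (dotC x) !dot0l mulr0 expr0n.
(* The squared norm of this vector is [dot y y] times the difference of the two sides. *)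
have := dot_ge0 (dot y y *: x - dot x y *: y).
rewrite !dotE (dotC y x) => h.
rewrite -subr_ge0 -(pmulr_rge0 _ (dot_gt0 y0)).
by apply: le_trans h _; rewrite le_eqVlt; apply/orP; left; apply/eqP; ring.
Qed.

Lemma enorm_ge0 x : 0 <= enorm x. Proof. exact: sqrtr_ge0. Qed.

Lemma enorm_sqr x : enorm x ^+ 2 = dot x x.
Proof. by rewrite sqr_sqrtr ?dot_ge0. Qed.

Lemma enormZ k x : enorm (k *: x) = `|k| * enorm x.
Proof.
by rewrite /enorm !dotE mulrA -expr2 sqrtrM ?sqr_ge0 // sqrtr_sqr.
Qed.

Lemma dot_le_enorm x y : dot x y <= enorm x * enorm y.
Proof.
rewrite (le_trans (ler_norm _)) // -ler_sqr ?nnegrE ?mulr_ge0 ?enorm_ge0 //.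
by rewrite exprMn !enorm_sqr real_normK ?num_real // CauchySchwarz_dot.
Qed.

Lemma enormD x y : enorm (x + y) <= enorm x + enorm y.
Proof.
rewrite -ler_sqr ?nnegrE ?addr_ge0 ?enorm_ge0 //.
rewrite sqrrD !enorm_sqr !dotE (dotC y x).
by have := dot_le_enorm x y; lra.
Qed.

Lemma coord_le_enorm i x : x ord0 i <= enorm x.
Proof.
rewrite -dot_delta (le_trans (dot_le_enorm _ _)) // {1}/enorm dot_delta.
by rewrite !mxE !eqxx sqrtr1 mul1r.
Qed.

Lemma exists_enorm1 : (0 < n)%N -> exists u : 'rV[R]_n, enorm u = 1.
Proof.
move=> n0; exists (delta_mx ord0 (Ordinal n0)).
by rewrite /enorm dot_delta !mxE !eqxx sqrtr1.
Qed.

Lemma dot_continuous : continuous (fun x => dot x x).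
Proof.
move=> x; apply: (@cvg_big R 'I_n +%R 0 xpredT (@add_continuous R) _ (nbhs x) _
  (fun i y => y ord0 i * y ord0 i)) => i _.
by apply: cvgM; exact: coord_continuous.
Qed.

End Dot.

(** * Distance to the boundary of the ball and of the half space *)

Section Boundary.
Variables (R : realType) (n : nat).
Implicit Types (x z v : 'rV[R]_n) (D : set 'rV[R]_n).

Lemma closure_segment D z v :
  (forall t : R, 0 < t -> t <= 1 -> D (z + t *: v)) -> closure D z.
Proof.
move=> Dzv B Bz.
have cv : z + t *: v @[t --> (0 : R)^'+] --> z.
  rewrite -[X in _ --> X]addr0 -[X in _ + X](scale0r v).
  apply: cvg_at_right_filter.
  by apply: cvgD; [exact: cvg_cst | apply: cvgZr_tmp; exact: cvg_id].
have : \forall t \near (0 : R)^'+, B (z + t *: v) by exact: cv.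
have h : \forall t \near (0 : R)^'+, D (z + t *: v).
  near=> t; apply: Dzv; first by near: t; exact: nbhs_right_gt.
  by near: t; exact: nbhs_right_le.
by move=> /(filterI h)/filter_ex[t [? ?]]; exists (z + t *: v).
Unshelve. all: by end_near. Qed.

(** The infimum is attained at [z]: the segment issuing from [z] puts [z] in the closure, and every
    boundary point of an open set lies outside it, hence is no closer to [x] than [z]. *)
Lemma bdist_open D x z v :
  open D -> ~ D z -> (forall t : R, 0 < t -> t <= 1 -> D (z + t *: v)) ->
  (forall y, ~ D y -> enorm (x - z) <= enorm (x - y)) ->
  bdist D x = enorm (x - z).
Proof.
move=> oD Dz Dzv le_xz; rewrite /bdist /boundary (interior_id D).1 //.
have zE : [set enorm (x - y) | y in closure D `\` D] (enorm (x - z)).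
  by exists z => //; split => //; exact: closure_segment Dzv.
have lbE : lbound [set enorm (x - y) | y in closure D `\` D] (enorm (x - z)).
  by move=> _ [y [_ Dy] <-]; exact: le_xz.
apply/eqP; rewrite eq_le ge_inf /=; [|by exists (enorm (x - z))|by []].
by apply: lb_le_inf => //; exists (enorm (x - z)).
Qed.

Lemma unit_ballE x : unit_ball x <-> dot x x < 1.
Proof.
by rewrite -enorm_sqr expr_lt1 ?enorm_ge0.
Qed.

Lemma open_unit_ball : open (@unit_ball R n).
Proof.
have -> : unit_ball = (fun x => dot x x) @^-1` `]-oo, 1[.
  by rewrite predeqE => x; rewrite unit_ballE /= in_itv /=.
by apply: open_comp => [x _|]; [exact: dot_continuous | exact: itv_open_ends_open].
Qed.

Lemma bdist_unit_ball x : (0 < n)%N -> unit_ball x ->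
  bdist unit_ball x = 1 - enorm x.
Proof.
move=> n0 xB; have xlt1 : enorm x < 1 := xB.
(* The nearest boundary point [u] is the radial projection of [x], or any unit vector when
   [x = 0]. *)
have [u [nu xu]] : exists u, enorm u = 1 /\ x = enorm x *: u.
  have [->|x0] := eqVneq x 0.
    have [u nu] := exists_enorm1 R n0; exists u.
    by rewrite /enorm dot0l sqrtr0 scale0r.
  have e0 : 0 < enorm x by rewrite sqrtr_gt0 dot_gt0.
  exists ((enorm x)^-1 *: x).
  rewrite enormZ ger0_norm ?invr_ge0 ?enorm_ge0 //.
  by rewrite scalerA mulVf ?mulfV ?scale1r ?gt_eqF.
have xuE : enorm (x - u) = 1 - enorm x.
  rewrite {1}xu -{2}[u]scale1r -scalerBl enormZ nu mulr1 ltr0_norm; lra.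
rewrite -xuE; apply: (@bdist_open _ _ _ (- u)) => [||t t0 t1|y].
- exact: open_unit_ball.
- by rewrite /unit_ball /= nu ltxx.
- rewrite /unit_ball /= scalerN -{1}[u]scale1r -scalerBl enormZ nu mulr1.
  by rewrite ger0_norm; lra.
- rewrite /unit_ball /= xuE => /negP; rewrite -leNgt => y1.
  have := enormD x (y - x); rewrite addrC subrK.
  by rewrite -opprB -scaleN1r enormZ normrN1 mul1r; lra.
Qed.

Lemma half_spaceE (i : 'I_n) x : i.+1 = n -> half_space x <-> 0 < x ord0 i.
Proof.
move=> iE; split=> [[j jE]|]; last by exists i.
by suff -> : j = i by []; apply/val_inj/succn_inj; rewrite jE.
Qed.

Lemma bdist_half_space (i : 'I_n) x : i.+1 = n -> half_space x ->
  bdist half_space x = x ord0 i.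
Proof.
move=> iE /(half_spaceE _ iE) xi.
(* [x - d] is the foot of the perpendicular on the bounding hyperplane. *)
pose d : 'rV[R]_n := x ord0 i *: delta_mx ord0 i.
have dE : enorm (x - (x - d)) = x ord0 i.
  rewrite opprB addrC subrK enormZ ger0_norm ?ltW //.
  by rewrite /enorm dot_delta !mxE !eqxx sqrtr1 mulr1.
rewrite -[RHS]dE; apply: (@bdist_open _ _ _ d) => [||t t0 t1|y].
- have -> : half_space = (fun y : 'rV[R]_n => y ord0 i) @^-1` `]0, +oo[.
    by rewrite predeqE => y; rewrite (half_spaceE _ iE) /= in_itv /= andbT.
  by apply: open_comp => [y _|]; [exact: coord_continuous | exact: itv_open_ends_open].
- by rewrite (half_spaceE _ iE) !mxE !eqxx mulr1 subrr ltxx.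
- by rewrite (half_spaceE _ iE) !mxE !eqxx mulr1 subrr add0r mulr_gt0.
- rewrite (half_spaceE _ iE) dE => /negP; rewrite -leNgt => yi.
  by have := coord_le_enorm i (x - y); rewrite !mxE; lra.
Qed.

End Boundary.

(** * Moebius maps acting on the light cone *)

Section Moebius.
Variables (R : realType) (n : nat).
Implicit Types (x y a b u : 'rV[R]_n) (p q : option 'rV[R]_n).

(* Represents [Some x] by (|x|^2, x, 1) and [None] by (1, 0, 0) on the light
   cone of R^(n+1,1); this is -2 times the Lorentz product. *)
Definition lorentz_sqdist p q : R :=
  match p, q with
  | Some x, Some y => dot (x - y) (x - y)
  | None, None => 0
  | _, _ => 1
  end.

(** With positive weights in the distance formula, this makes a Moebius map injective, the point at
    infinity included. *)
Lemma lorentz_sqdist_eq0 p q : lorentz_sqdist p q = 0 -> p = q.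
Proof.
case: p q => [x|] [y|] //= => [/eqP|/eqP|/eqP]; rewrite ?oner_eq0 //.
by rewrite dot_eq0 subr_eq0 => /eqP ->.
Qed.

(** A linear form on R^(n+1,1) evaluated at the lift of [p]; hence the leading coefficient at
    infinity. *)
Definition sphere_fun (Q : R * 'rV[R]_n * R) p : R :=
  if p is Some x then Q.1.1 * dot x x + dot Q.1.2 x + Q.2 else Q.1.1.

(** The quadratic form dual to the Lorentz form, which Lorentz isometries preserve. *)
Definition discr (Q : R * 'rV[R]_n * R) : R :=
  dot Q.1.2 Q.1.2 - 4 * (Q.1.1 * Q.2).

(** The clause on [Q] expresses the adjoint linear action without matrices of size n + 2; one weight
    [w] serves both identities. *)
Definition lorentz_conformal (g : option 'rV[R]_n -> option 'rV[R]_n) : Prop :=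
  exists w : option 'rV[R]_n -> R,
  [/\ forall p, 0 < w p,
      forall p q, lorentz_sqdist (g p) (g q) = w p * w q * lorentz_sqdist p q
    & forall Q, exists2 Q', discr Q' = discr Q &
        forall p, sphere_fun Q (g p) = w p * sphere_fun Q' p].

Lemma lorentz_conformal_id : lorentz_conformal id.
Proof.
exists (fun=> 1); split => // [p q|Q]; first by rewrite !mul1r.
by exists Q => // p; rewrite mul1r.
Qed.

Lemma lorentz_conformal_comp g h :
  lorentz_conformal g -> lorentz_conformal h -> lorentz_conformal (g \o h).
Proof.
move=> [v [v0 gd gQ]] [w [w0 hd hQ]].
exists (fun p => v (h p) * w p); split => [p|p q|Q]; first exact: mulr_gt0.
  by rewrite /= gd hd; ring.
have [Q1 Q1d Q1E] := gQ Q; have [Q2 Q2d Q2E] := hQ Q1.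
by exists Q2 => [|p]; [rewrite Q2d | rewrite /= Q1E Q2E mulrA].
Qed.

Lemma lorentz_conformal_reflection a t :
  a != 0 -> lorentz_conformal (reflection a t).
Proof.
move=> /dot_gt0/lt0r_neq0 a0; exists (fun=> 1); split => // [[x|] [y|]|].
- by rewrite /= !dotE ?(dotC a) ?(dotC y x); field.
- by rewrite /= !mul1r.
- by rewrite /= !mul1r.
- by rewrite /= !mul1r.
(* The reflection changes |x|^2 by -4 t (<x, a> - t) / <a, a>, which is affine in [x]. So [al] is
   kept and the function changes by -s (<x, a> - t). *)
move=> [[al b] ga]; pose s := (4 * t * al + 2 * dot b a) / dot a a.
exists (al, b - s *: a, ga + s * t).
  by rewrite /discr /= !dotE (dotC a b) /s; field.
move=> [x|]; rewrite /= mul1r // !dotE ?(dotC a) /s.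
by field.
Qed.

Lemma lorentz_conformal_inversion a r :
  0 < r -> lorentz_conformal (inversion a r).
Proof.
move=> r0; have rn0 : r != 0 by rewrite gt_eqF.
have xa0 x : x != a -> dot (x - a) (x - a) != 0 by rewrite dot_eq0 subr_eq0.
(* Away from [a] this is the dilatation factor of the inversion; the weights at [a] and at infinity
   are forced by the distance identity with an ordinary second point. *)
exists (fun p => if p is Some x then
  if x == a then (r ^+ 2)^-1 else r ^+ 2 / dot (x - a) (x - a) else r ^+ 2).
split => [[x|]|p q|[[al b] ga]].
- case: eqP => [_|/eqP xa]; first by rewrite invr_gt0 exprn_gt0.
  by rewrite divr_gt0 ?exprn_gt0 // dot_gt0 // subr_eq0.
- by rewrite exprn_gt0.
- have inv_sqdist x y : x != a -> y != a ->
      lorentz_sqdist (inversion a r (Some x)) (inversion a r (Some y)) =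
      r ^+ 2 / dot (x - a) (x - a) * (r ^+ 2 / dot (y - a) (y - a)) *
      dot (x - y) (x - y).
    move=> xa ya; rewrite /= (negbTE xa) (negbTE ya) /= !enorm_sqr.
    rewrite opprD addrACA subrr add0r.
    have -> : x - y = (x - a) - (y - a) by rewrite opprB addrA subrK.
    move: (xa0 _ xa) (xa0 _ ya); move: (x - a) (y - a) => X Y XX YY.
    by rewrite !dotE (dotC Y X); field; apply/andP; split.
  have inv_dist_a x : x != a ->
      dot (a + (r ^+ 2 / enorm (x - a) ^+ 2) *: (x - a) - a)
          (a + (r ^+ 2 / enorm (x - a) ^+ 2) *: (x - a) - a) =
      r ^+ 2 * (r ^+ 2 / dot (x - a) (x - a)).
    move=> /xa0 xx; rewrite enorm_sqr addrC addKr !dotZl !dotZr.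
    by move: xx; move: (dot _ _) => N N0; field.
  have dot_anti x y : dot (x - y) (x - y) = dot (y - x) (y - x).
    by rewrite -opprB !dotE; ring.
  case: p q => [x|] [y|].
  + have [->|xa] := eqVneq x a; have [->|ya] := eqVneq y a.
    * by rewrite /= eqxx subrr dot0l mulr0.
    * rewrite /= eqxx (negbTE ya) /= (dot_anti a).
      by move: (xa0 _ ya) => yy; field; apply/andP; split.
    * rewrite /= eqxx (negbTE xa) /=.
      by move: (xa0 _ xa) => xx; field; apply/andP; split.
    * exact: inv_sqdist.
  + rewrite /=; case: eqP => [_|/eqP xa] /=; first by field.
    by rewrite inv_dist_a //; ring.
  + rewrite /=; case: eqP => [_|/eqP ya] /=; first by field.
    by rewrite dot_anti inv_dist_a //; ring.
  + by rewrite /= subrr dot0l mulr0.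
(* Taylor expansion at [a]: [e * r ^+ 2] is the value there and [d] the gradient. With X = x - a,
   the value at the image of [x] is r^2 / |X|^2 times e |X|^2 + <d, X> + al r^2, and the witness
   rewrites this last sum in terms of [x]. *)
- pose e := (al * dot a a + dot b a + ga) / r ^+ 2.
  pose d := (2 * al) *: a + b.
  exists (e, d - (2 * e) *: a, e * dot a a - dot d a + al * r ^+ 2).
    by rewrite /discr /= /d /e !dotE ?(dotC a b); field.
  move=> [x|] /=; last by rewrite /e; field.
  case: eqP => [->|/eqP/xa0]; first by rewrite /= !dotE; field.
  rewrite /= enorm_sqr /d /e.
  rewrite !dotE (dotC a x).
  by move=> N0; field; apply/andP; split.
Qed.

Lemma moebius_lorentz_conformal g : moebius g -> lorentz_conformal g.
Proof.
elim=> [|a t {}g a0 _ IH|a r {}g r0 _ IH]; first exact: lorentz_conformal_id.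
  by apply: lorentz_conformal_comp IH; exact: lorentz_conformal_reflection.
by apply: lorentz_conformal_comp IH; exact: lorentz_conformal_inversion.
Qed.

(* A sphere function positive exactly in the unit ball vanishes on the unit
   sphere; antipodal points then kill its linear part. *)
Lemma sphere_fun_unit_ball Q : (0 < n)%N ->
  (forall x, unit_ball x -> 0 < sphere_fun Q (Some x)) ->
  (forall x, ~ unit_ball x -> sphere_fun Q (Some x) <= 0) ->
  discr Q = 1 ->
  forall x, sphere_fun Q (Some x) = (1 - dot x x) / 2.
Proof.
case: Q => -[al b] ga n0 Qpos Qneg; rewrite /discr /= => Qd.
have sph u : enorm u = 1 -> al + dot b u + ga = 0.
  move=> nu; have du : dot u u = 1 by rewrite -enorm_sqr nu expr1n.
  apply/eqP; rewrite eq_le; apply/andP; split.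
    have /Qneg : ~ unit_ball u by rewrite /unit_ball /= nu ltxx.
    by rewrite /= du mulr1.
  (* The reverse inequality comes from the positive values along the radius, as [(1 - t) *: u] tends
     to [u]. *)
  have h (t : R) : 0 < t -> t <= 1 ->
      0 < al * (1 - t) ^+ 2 + (1 - t) * dot b u + ga.
    move=> t0 t1; have /Qpos : unit_ball ((1 - t) *: u).
      by rewrite unit_ballE !dotE du; nra.
    by rewrite /= !dotE du; nra.
  have c1 : al * (1 - t) ^+ 2 + (1 - t) * dot b u + ga @[t --> (0 : R)^'+] -->
      al * (1 - 0) ^+ 2 + (1 - 0) * dot b u + ga.
    apply: cvg_at_right_filter.
    have ct : (1 - t) @[t --> (0:R)] --> (1 - 0 : R).
      by apply: cvgB; [exact: cvg_cst|exact: cvg_id].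
    apply: cvgD; last exact: cvg_cst.
    apply: cvgD; apply: cvgM; try exact: cvg_cst; try exact: ct.
    by rewrite expr2; apply: cvgM; exact: ct.
  have -> : al + dot b u + ga = al * (1 - 0) ^+ 2 + (1 - 0) * dot b u + ga.
    by ring.
  rewrite -(cvg_lim _ c1) //; apply: limr_ge; first by apply: cvgP c1.
  by near=> t; apply/ltW/h; near: t; [exact: nbhs_right_gt|exact: nbhs_right_le].
have sphN u : enorm u = 1 -> dot b u = 0.
  move=> nu; have := sph _ nu; have := sph (- u).
  by rewrite -scaleN1r enormZ normrN1 mul1r dotZr => /(_ nu); lra.
have b0 : b = 0.
  have [//|bn0] := eqVneq b 0.
  have e0 : 0 < enorm b by rewrite sqrtr_gt0 dot_gt0.
  have := sphN ((enorm b)^-1 *: b).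
  rewrite enormZ ger0_norm ?invr_ge0 ?enorm_ge0 // mulVf ?gt_eqF // dotZr.
  move=> /(_ erefl)/eqP; rewrite mulf_eq0 invr_eq0 gt_eqF //= dot_eq0.
  by move/eqP.
have alE : al = - ga.
  by have [u /sph] := exists_enorm1 R n0; rewrite b0 dot0l; lra.
have ga0 : 0 < ga.
  have := Qpos 0; rewrite unit_ballE /= !dot0l dotC dot0l mulr0 !add0r; apply.
  exact: ltr01.
(* The discriminant is now 4 ga^2, and [ga] is the positive value at the origin. *)
have ga2 : ga = 2^-1.
  by move: Qd; rewrite b0 dot0l alE; nra.
by move=> x; rewrite b0 dot0l alE ga2; field.
Unshelve. all: by end_near. Qed.

End Moebius.

(** * From the ball to the half space: weight, last coordinate and distance ratio *)

Lemma moebius_onto_half_space (R : realType) (n : nat)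
    (f : 'rV[R]_n -> 'rV[R]_n) (i : 'I_n) :
  i.+1 = n -> moebius_onto unit_ball half_space f ->
  exists w : 'rV[R]_n -> R,
  [/\ forall x, 0 < w x,
      forall x y, unit_ball x -> unit_ball y ->
        dot (f x - f y) (f x - f y) = w x * w y * dot (x - y) (x - y)
    & forall x, unit_ball x -> f x ord0 i = w x * ((1 - dot x x) / 2)].
Proof.
move=> iE [fB [g /moebius_lorentz_conformal[w [w0 gd gQ]] gf]].
have n0 : (0 < n)%N by rewrite -iE.
have [Q Qd QE] := gQ (0, delta_mx ord0 i, 0).
have coordE y : sphere_fun (0, delta_mx ord0 i, 0) (Some y) = y ord0 i.
  by rewrite /= mul0r add0r addr0 dot_delta.
have Q1 : discr Q = 1.
  by rewrite Qd /discr /= dot_delta !mxE !eqxx mul0r mulr0 subr0.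
have QpE := sphere_fun_unit_ball n0 _ _ Q1.
have {}QpE : forall x, sphere_fun Q (Some x) = (1 - dot x x) / 2.
  apply: QpE => x xB.
    rewrite -(pmulr_rgt0 _ (w0 (Some x))) -QE gf // coordE.
    by rewrite -(half_spaceE _ iE) -fB; exists x.
  rewrite -(pmulr_rle0 _ (w0 (Some x))) -QE.
  (* If [x] is sent to infinity, the value is the leading coefficient 0. *)
  case gx: (g (Some x)) => [y|]; last by [].
  (* A point outside the ball sent into the half space would share its image with some [z] of the
     ball, against injectivity of [g]. *)
  rewrite coordE leNgt; apply/negP; rewrite -(half_spaceE _ iE) -fB => -[z zB zy].
  apply: xB; suff [->] : Some x = Some z by [].
  apply: lorentz_sqdist_eq0; apply/eqP.
  rewrite -(inj_eq (mulfI (lt0r_neq0 (mulr_gt0 (w0 (Some x)) (w0 (Some z)))))).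
  by rewrite -gd gx gf // zy /= subrr dot0l mulr0.
exists (w \o Some); split => [x|x y xB yB|x xB] /=; first exact: w0.
  by have := gd (Some x) (Some y); rewrite !gf.
by rewrite -coordE -gf // QE QpE.
Qed.

(** The factor sqrt (w(x) w(y)) occurs in numerator and denominator and cancels; splitting 1 - |x|^2
    as (1 - |x|) (1 + |x|) leaves the last factor. *)
Lemma half_space_ratio (R : realType) (n : nat)
    (f : 'rV[R]_n -> 'rV[R]_n) x y : (0 < n)%N ->
  moebius_onto unit_ball half_space f -> unit_ball x -> unit_ball y ->
  enorm (f x - f y) /
    Num.sqrt (bdist half_space (f x) * bdist half_space (f y)) =
  enorm (x - y) / Num.sqrt (bdist unit_ball x * bdist unit_ball y) *
    (2 / Num.sqrt ((1 + enorm x) * (1 + enorm y))).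
Proof.
move=> n0 hf xB yB.
have fH z : unit_ball z -> half_space (f z).
  by case: hf => <- _ zB; exists z.
have n1 : (n.-1 < n)%N by rewrite ltn_predL.
have iE : (Ordinal n1).+1 = n by rewrite /= prednK.
have [w [w0 fd fi]] := moebius_onto_half_space iE hf.
have x1 : enorm x < 1 := xB; have y1 : enorm y < 1 := yB.
have x0 := enorm_ge0 x; have y0 := enorm_ge0 y.
rewrite !(bdist_half_space iE) ?bdist_unit_ball //; try exact: fH.
have -> : enorm (f x - f y) = Num.sqrt (w x * w y) * enorm (x - y).
  by rewrite /enorm fd // sqrtrM // mulr_ge0 ?ltW.
rewrite !fi // -!enorm_sqr.
have -> : w x * ((1 - enorm x ^+ 2) / 2) * (w y * ((1 - enorm y ^+ 2) / 2)) =
    (w x * w y) * (((1 - enorm x) * (1 - enorm y)) *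
    (((1 + enorm x) * (1 + enorm y)) * (2^-1) ^+ 2)) by field.
have wp := mulr_gt0 (w0 x) (w0 y).
have mp : 0 < (1 - enorm x) * (1 - enorm y) by rewrite mulr_gt0 ?subr_gt0.
have pp : 0 < (1 + enorm x) * (1 + enorm y) by rewrite mulr_gt0 //; lra.
rewrite (sqrtrM _ (ltW wp)) (sqrtrM _ (ltW mp)) (sqrtrM _ (ltW pp)) sqrtr_sqr.
rewrite ger0_norm //.
have sqrt_neq0 (a : R) : 0 < a -> Num.sqrt a != 0.
  by move=> a0; rewrite gt_eqF // sqrtr_gt0.
by field; rewrite !sqrt_neq0.
Qed.

(** * Comparison of logarithms and its sharpness at infinity and at 0 *)

Section LogBounds.
Variable R : realType.
Implicit Types c s k C : R.

Lemma ln_ratio_lb c s k : 0 < c -> 0 <= s -> 1 <= k ->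
  ln (1 + c * s) <= ln (1 + c * (s * k)).
Proof.
move=> c0 s0 k1; have cs : 0 <= c * s by rewrite mulr_ge0 // ltW.
have csk : c * s <= c * s * k by rewrite ler_peMr.
by rewrite mulrA ler_ln ?posrE; lra.
Qed.

Lemma ln_ratio_ub c s k : 0 < c -> 0 <= s -> 0 <= k -> k <= 2 ->
  ln (1 + c * (s * k)) <= 2 * ln (1 + c * s).
Proof.
move=> c0 s0 k0 k2; have cs : 0 <= c * s by rewrite mulr_ge0 // ltW.
rewrite mulr_natl -lnXn; last lra.
have csk0 : 0 <= c * s * k by rewrite mulr_ge0.
have csk2 : c * s * k <= c * s * 2 by rewrite ler_wpM2l.
have cs2 := sqr_ge0 (c * s).
by rewrite mulrA ler_ln ?posrE ?exprn_gt0 //; lra.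
Qed.

(** A bounded factor [k] costs at most ln 2 in the logarithm, so (C - 1) ln (1 + c s) <= ln 2 for
    arbitrarily large [s]. *)
Lemma ln_coef_lb c C : 0 < c ->
  (forall M : R, exists2 s, M <= s &
     exists2 k, 0 <= k <= 2 & C * ln (1 + c * s) <= ln (1 + c * (s * k))) ->
  C <= 1.
Proof.
move=> c0 h; rewrite leNgt; apply/negP => C1.
(* This threshold makes (C - 1) ln (1 + c s) at least 2 ln 2, which exceeds ln 2. *)
have [s sM [k /andP[k0 k2] sk]] := h (expR (2 * ln 2 / (C - 1)) / c).
have e0 := expR_gt0 (2 * ln 2 / (C - 1)).
have cs : expR (2 * ln 2 / (C - 1)) <= c * s by rewrite (mulrC c) -ler_pdivrMr.
have l2 : 0 < ln (2 : R) by apply: ln_gt0; lra.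
have : ln (1 + c * (s * k)) <= ln 2 + ln (1 + c * s).
  have csk0 : 0 <= c * s * k by rewrite mulr_ge0 //; lra.
  have csk2 : c * s * k <= c * s * 2 by rewrite ler_wpM2l //; lra.
  rewrite -lnM ?posrE; [|lra|lra].
  by rewrite mulrA ler_ln ?posrE; lra.
have : 2 * ln 2 / (C - 1) <= ln (1 + c * s).
  by rewrite -[leLHS]expRK ler_ln ?posrE; lra.
rewrite ler_pdivrMr; last by rewrite subr_gt0.
by nra.
Qed.

(* Compare u / (1 + u) <= ln (1 + u) <= u to first order at 0. *)
Lemma ln_coef_ub c C : 0 < c -> 0 < C ->
  (forall e : R, 0 < e -> exists2 s, 0 < s <= e &
     exists2 k, 2 - e <= k <= 2 & ln (1 + c * (s * k)) <= C * ln (1 + c * s)) ->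
  2 <= C.
Proof.
move=> c0 C0 h; rewrite leNgt; apply/negP => C2.
(* The estimates below end in 2 - e <= C + 4 c e, that is 2 - C <= e (1 + 4 c); this [e] makes the
   right side half of 2 - C. *)
pose e := (2 - C) / (2 * (1 + 4 * c)).
have c4 : 0 < 1 + 4 * c by lra.
have eE : e * (1 + 4 * c) = (2 - C) / 2 by rewrite /e; field; exact: lt0r_neq0.
have e0 : 0 < e by rewrite /e divr_gt0; lra.
have [s /andP[s0 se] [k /andP[ek k2] sk]] := h e e0.
have ec : 0 < e * c by rewrite mulr_gt0.
have k0 : 0 < k by lra.
have u0 : 0 < c * s by rewrite mulr_gt0.
have v0 : 0 < c * (s * k) by rewrite !mulr_gt0.
have ub : ln (1 + c * s) <= c * s by rewrite le_ln1Dx //; lra.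
have lb : c * (s * k) / (1 + c * (s * k)) <= ln (1 + c * (s * k)).
  (* Lower bound from the upper one: ln (1 + v) = - ln (1 - v / (1 + v)). *)
  rewrite -[leRHS]opprK -lnV ?posrE; last lra.
  rewrite lerNr.
  rewrite [X in ln X](_ : _ = 1 - c * (s * k) / (1 + c * (s * k))); last first.
    by field; apply: lt0r_neq0; rewrite addr_gt0.
  apply: le_ln1Dx; rewrite ltrN2 ltr_pdivrMr; lra.
have : c * (s * k) / (1 + c * (s * k)) <= C * (c * s).
  by apply: le_trans lb (le_trans sk _); rewrite ler_pM2l.
rewrite ler_pdivrMr; last lra.
have -> : c * (s * k) = k * (c * s) by ring.
have -> : C * (c * s) * (1 + k * (c * s)) = C * (1 + c * s * k) * (c * s) by ring.
rewrite ler_pM2r // => kC.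
have : C * (c * s * k) <= 2 * (c * e * 2).
  by rewrite !ler_pM //; rewrite ?mulr_ge0 ?ltW //; rewrite ler_pM2l.
by lra.
Qed.

End LogBounds.

(** * The two-sided estimate and the optimality of its constants *)

Theorem theorem1p2 (R : realType) (n : nat) (hn : (2 <= n)%N) (c : R)
    (hc : 2 <= c) (f : 'rV[R]_n -> 'rV[R]_n)
    (hf : moebius_onto unit_ball half_space f) :
  [/\ forall x y : 'rV[R]_n, unit_ball x -> unit_ball y ->
        hmetric unit_ball c x y <= hmetric half_space c (f x) (f y) /\
        hmetric half_space c (f x) (f y) <= 2 * hmetric unit_ball c x y,
      forall C : R, 0 < C ->
        (forall x y : 'rV[R]_n, unit_ball x -> unit_ball y ->
          C * hmetric unit_ball c x y <= hmetric half_space c (f x) (f y)) ->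
        C <= 1
    & forall C : R, 0 < C ->
        (forall x y : 'rV[R]_n, unit_ball x -> unit_ball y ->
          hmetric half_space c (f x) (f y) <= C * hmetric unit_ball c x y) ->
        2 <= C].
Proof.
have n0 : (0 < n)%N by exact: ltnW.
have c0 : 0 < c by lra.
have [u nu] := exists_enorm1 R n0.
have ruE (r : R) : 0 <= r -> enorm (r *: u) = r.
  by move=> r0; rewrite enormZ nu mulr1 ger0_norm.
have factor (x y : 'rV[R]_n) : unit_ball x -> unit_ball y ->
    1 <= 2 / Num.sqrt ((1 + enorm x) * (1 + enorm y)) <= 2.
  rewrite /unit_ball /= => x1 y1; have x0 := enorm_ge0 x; have y0 := enorm_ge0 y.
  have p1 : 1 <= (1 + enorm x) * (1 + enorm y) by nra.
  have p4 : (1 + enorm x) * (1 + enorm y) <= 2 ^+ 2 by nra.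
  have s1 : 1 <= Num.sqrt ((1 + enorm x) * (1 + enorm y)).
    by rewrite -[leLHS]sqrtr1 ler_wsqrtr.
  have s2 : Num.sqrt ((1 + enorm x) * (1 + enorm y)) <= 2.
    by rewrite -[leRHS]ger0_norm // -sqrtr_sqr ler_wsqrtr.
  have s0 := lt_le_trans ltr01 s1.
  by rewrite ler_pdivlMr // ler_pdivrMr // mul1r s2 ler_peMr.
have s_ge0 (x y : 'rV[R]_n) :
    0 <= enorm (x - y) / Num.sqrt (bdist unit_ball x * bdist unit_ball y).
  by rewrite divr_ge0 ?enorm_ge0 ?sqrtr_ge0.
have hfE x y (xB : unit_ball x) (yB : unit_ball y) :
  hmetric half_space c (f x) (f y) = ln (1 + c * (enorm (x - y) /
    Num.sqrt (bdist unit_ball x * bdist unit_ball y) *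
    (2 / Num.sqrt ((1 + enorm x) * (1 + enorm y))))).
  by rewrite /hmetric half_space_ratio.
split => [x y xB yB|C _ hC|C C0 hC].
- have /andP[k1 k2] := factor _ _ xB yB.
  rewrite hfE //; split; first exact: ln_ratio_lb.
  by apply: ln_ratio_ub => //; lra.
(* Antipodal points tending to the unit sphere. *)
- apply: (ln_coef_lb c0) => M; pose r := (1 + `|M|) / (2 + `|M|).
  have M0 := normr_ge0 M; have MM := ler_norm M.
  have r1E : 1 - r = (2 + `|M|)^-1.
    by rewrite /r; field; apply: lt0r_neq0; rewrite ltr_wpDr.
  have r1 : 0 < 1 - r by rewrite r1E invr_gt0; lra.
  have r0 : 0 <= r by rewrite /r divr_ge0; lra.
  have nE : enorm (- (r *: u)) = r by rewrite -scaleN1r enormZ normrN1 mul1r ruE.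
  have xB : unit_ball (r *: u) by rewrite /unit_ball /= ruE //; lra.
  have yB : unit_ball (- (r *: u)) by rewrite /unit_ball /= nE //; lra.
  have := hC _ _ xB yB; rewrite hfE // /hmetric => ineq.
  exists (enorm (r *: u - - (r *: u)) /
    Num.sqrt (bdist unit_ball (r *: u) * bdist unit_ball (- (r *: u)))).
    (* The ratio is 2 r / (1 - r) = 2 (1 + |M|), which is at least [M]. *)
    rewrite !bdist_unit_ball // nE ruE // -expr2 sqrtr_sqr (gtr0_norm r1).
    rewrite opprK -mulr2n -scaler_nat enormZ ruE // ger0_norm // r1E invrK.
    rewrite -mulrA (_ : r * _ = 1 + `|M|); first lra.
    by rewrite /r divfK // gt_eqF //; lra.
  exists (2 / Num.sqrt ((1 + enorm (r *: u)) * (1 + enorm (- (r *: u))))) => //.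
  by have /andP[k1 ->] := factor _ _ xB yB; rewrite andbT; lra.
(* The origin and a point tending to it. *)
- apply: (ln_coef_ub c0 C0) => e e0.
  (* With r <= 1/2 the ratio satisfies r / sqrt (1 - r) <= r / (1 - r) <= 2 r <= e. *)
  have [r [r0 r2 re]] : exists r : R, [/\ 0 < r, r <= 1 / 2 & 2 * r <= e].
    have [e1|e1] := leP e 1; first by exists (e / 2); split; lra.
    by exists (1 / 2); split; lra.
  have xB : unit_ball (0 : 'rV[R]_n).
    by rewrite -(scale0r u) /unit_ball /= ruE //; lra.
  have yB : unit_ball (r *: u) by rewrite /unit_ball /= ruE //; lra.
  have := hC _ _ yB xB; rewrite hfE // /hmetric => ineq.
  exists (enorm (r *: u - 0) /
      Num.sqrt (bdist unit_ball (r *: u) * bdist unit_ball (0 : 'rV[R]_n))).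
    rewrite !bdist_unit_ball // subr0 -(scale0r u) !ruE ?(ltW r0) //.
    rewrite subr0 mulr1; have r1 : 0 < 1 - r by lra.
    have sr : 1 - r <= Num.sqrt (1 - r).
      rewrite -[leLHS]gtr0_norm // -sqrtr_sqr ler_wsqrtr // expr2.
      by rewrite ler_piMr; lra.
    rewrite divr_gt0 ?sqrtr_gt0 //= ler_pdivrMr ?sqrtr_gt0 //.
    have : e * (1 - r) <= e * Num.sqrt (1 - r) by rewrite ler_pM2l.
    by nra.
  exists (2 / Num.sqrt ((1 + enorm (r *: u)) * (1 + enorm (0 : 'rV[R]_n)))) => //.
  have /andP[_ ->] := factor _ _ yB xB; rewrite andbT.
  rewrite -(scale0r u) !ruE ?(ltW r0) // addr0 mulr1.
  (* Then 2 / sqrt (1 + r) >= 2 / (1 + r) >= 2 - 2 r >= 2 - e. *)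
  have sr : Num.sqrt (1 + r) <= 1 + r.
    have r1 : 0 < 1 + r by lra.
    by rewrite -[leRHS]gtr0_norm // -sqrtr_sqr ler_wsqrtr // expr2 ler_peMr; lra.
  rewrite ler_pdivlMr ?sqrtr_gt0; last lra.
  have s0 : 0 < Num.sqrt (1 + r) by rewrite sqrtr_gt0; lra.
  by nra.
Qed.
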